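(* For every cardinal $\kappa$ such that $\omega_1\le\kappa\le\mathfrak{b}$ there exists a meager in itself countable dense homogeneous (separable) metric space of size $\kappa$.
   Context: A separable topological space $X$ is countable dense homogeneous (CDH) if for any two countable dense subsets $D,E$ of $X$ there is a homeomorphism $f\colon X\to X$ with $f[D]=E$; CDH spaces are thus separable by definition. A space is meager in itself if it is a countable union of its nowhere dense subsets. $\mathfrak{b}$ is the bounding number, i.e. the least cardinality of a subset of $\omega^\omega$ that is unbounded with respect to eventual domination $\le^*$. *)

(* Defs.v *)
From mathcomp Require Import all_boot all_order all_algebra.
From mathcomp Require Import all_classical all_reals all_analysis.

Set Implicit Arguments.
Unset Strict Implicit.
Unset Printing Implicit Defensive.

Local Open Scope classical_set_scope.
Local Open Scope card_scope.

(* Cardinals are represented by types, compared with [#<=] and [#=]. *)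
Definition least_cardinal (P : Type -> Prop) (k : Type) : Prop :=
  P k /\ forall l : Type, P l -> [set: k] #<= [set: l].

Definition uncountable (k : Type) : Prop := ~ countable [set: k].

Definition eventually_le (f g : nat -> nat) : Prop :=
  \forall n \near \oo, (f n <= g n)%N.

Definition unbounded (F : set (nat -> nat)) : Prop :=
  ~ exists g, forall f, F f -> eventually_le f g.

Definition card_of_unbounded (k : Type) : Prop :=
  exists F : set (nat -> nat), unbounded F /\ [set: k] #= F.

Lemma injective_card_le (T U : Type) (f : T -> U) :
  injective f -> [set: T] #<= [set: U].
Proof.
move=> finj; have h : f @` [set: T] #= [set: T].
  by apply: inj_card_eq => x y _ _; exact: finj.
by rewrite -(card_le_eql h) card_leT.
Qed.

(* A maximal set of choice functions on which every projection is injective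
   has a bijective projection; its target is the least of the given types. *)
Lemma least_cardinal_exists (P : Type -> Prop) (k0 : Type) :
  P k0 -> exists k, least_cardinal P k.
Proof.
move=> Pk0; pose I := {k : Type | P k}.
pose T := forall i : I, sval i.
pose good (S : set T) :=
  forall (s t : T) (i : I), S s -> S t -> s i = t i -> s = t.
have [F Fgood Ftot|S [gS maxS]] := @Zorn_bigcup T good.
  move=> s t i [A FA As] [B FB Bt].
  by case: (Ftot A B FA FB) => AB; [apply: (Fgood B)|apply: (Fgood A)] => //;
     exact: AB.
have [[i surj_i]|nsurj] :=
    pselect (exists i : I, forall x : sval i, exists2 s, S s & s i = x).
  exists (sval i); split; first exact: svalP.
  move=> l Pl; pose j : I := exist _ l Pl.
  pose c x : T := s2val (cid2 (surj_i x)).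
  have cS x : S (c x) by rewrite /c; case: cid2.
  have cK x : c x i = x by rewrite /c; case: cid2.
  apply: (@injective_card_le _ _ (fun x => c x j : l)) => x y cxy.
  by rewrite -(cK x) -(cK y) (gS _ _ j (cS x) (cS y) cxy).
have miss (i : I) : exists x : sval i, forall s, S s -> s i <> x.
  apply: contrapT => H; apply: nsurj; exists i => x; apply: contrapT => Hx.
  by apply: H; exists x => s Ss six; apply: Hx; exists s.
pose f : T := fun i => sval (cid (miss i)).
have fP i s : S s -> s i <> f i by rewrite /f; case: cid => /= x; apply.
have i0 : I by exists k0.
exfalso; apply: (maxS (S `|` [set f])).
  split; first by move=> ?; left.
  by move=> /(_ f) Sf; apply: (fP i0 f) => //; apply: Sf; right.
move=> s t i [Ss|->] [St|->] //; first exact: gS.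
  by move/(fP i _ Ss).
by move/esym/(fP i _ St).
Qed.

Lemma uncountable_exists : exists k, uncountable k.
Proof.
exists (nat -> bool) => /countable_injP[f finj].
pose d n := `[< exists2 g : nat -> bool, f g = n & ~~ g n >].
have : d (f d) = ~~ d (f d).
  apply/idP/idP => [/asboolP[g fg]|nd].
    have -> : d = g by apply: finj; rewrite ?inE.
    by rewrite fg.
  by apply/asboolP; exists d.
by case: (d _).
Qed.

Lemma card_of_unbounded_exists : exists k, card_of_unbounded k.
Proof.
exists (nat -> nat), [set: nat -> nat]; split; last exact: card_eqxx.
move=> [g /(_ (fun n => (g n).+1) I)[N _ /(_ N (leqnn N))]] /=.
by rewrite ltnn.
Qed.

Lemma omega1_exists : exists k, least_cardinal uncountable k.
Proof. by have [k /least_cardinal_exists] := uncountable_exists. Qed.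

Definition omega1 : Type := sval (cid omega1_exists).

Lemma bounding_number_exists : exists k, least_cardinal card_of_unbounded k.
Proof. by have [k /least_cardinal_exists] := card_of_unbounded_exists. Qed.

Definition bounding_number : Type := sval (cid bounding_number_exists).

Definition separable (X : topologicalType) : Prop :=
  exists D : set X, countable D /\ dense D.

Definition homeomorphism (X Y : topologicalType) (f : X -> Y) : Prop :=
  exists g : Y -> X, [/\ cancel f g, cancel g f, continuous f & continuous g].

Definition countable_dense_homogeneous (X : topologicalType) : Prop :=
  separable X /\
  forall D E : set X, countable D -> dense D -> countable E -> dense E ->
    exists f : X -> X, homeomorphism f /\ f @` D = E.

Definition nowhere_dense (X : topologicalType) (A : set X) : Prop :=
  (closure A)° = set0.

Definition meager_in_itself (X : topologicalType) : Prop :=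
  exists A : nat -> set X,
    (forall n, nowhere_dense (A n)) /\ \bigcup_n A n = [set: X].

(* Main.v *)
Require Import Defs.
From Stdlib Require Inverse_Image.
From HB Require Import structures.
From mathcomp Require Import all_boot all_order all_algebra.
From mathcomp Require Import all_classical all_reals all_analysis.
From mathcomp Require Import wochoice.

(* Call a subset of the Baire space a lambda-set if its countable subsets are
   relatively G_delta. A strictly <*-increasing family of length [kappa] whose
   proper initial segments have size less than the bounding number is a
   lambda-set [Z]: a countable [C] below some [f_a] lies in the G_delta set of
   functions infinitely often below [f_a], which misses the later members, and
   fewer than b many points are separated from [C] by dominating the functions
   that measure how long they agree with the points of [C].

   The space [X] consists of the sequences in [Z] that are eventually constant
   with value [z0]. It is again a lambda-set, and every nonempty open set [U]
   contains, for each countable [C], a closed copy of [X] missing [C]: fix a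
   finite prefix and then a coordinate in [Z] not used by [C]. For countable
   dense [D] and [D'], the complements are unions of closed sets [F n] and
   [F' n]. A homeomorphism of [X] taking [D] to [D'] is built as a union of
   homeomorphisms between closed nowhere dense sets. At each stage [X] is
   partitioned into clopen sets matched in pairs. In a pair [(U, U')] without a
   partial map, some [F n `&` U] is embedded in [U' `\` D'], or a point of [D]
   is sent to a point of [D'], or vice versa. A pair with a partial map [G] is
   split, by means of retractions onto the domain and the range of [G], into
   small neighborhoods of pieces of [G] and one remaining pair without a
   partial map. *)

Set Implicit Arguments.
Unset Strict Implicit.
Unset Printing Implicit Defensive.

Import Order.TTheory GRing.Theory Num.Theory.
Local Open Scope classical_set_scope.
Local Open Scope card_scope.

(** * Cardinal arithmetic *)

(** A maximal graph of a partial bijection between [A] and [B] has full domain or full range, since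
    otherwise one more pair could be added. *)
Lemma set_inj_total (T U : Type) (A : set T) (B : set U) (u0 : U) (t0 : T) :
  (exists2 f : T -> U, set_fun A B f & set_inj A f) \/
  (exists2 g : U -> T, set_fun B A g & set_inj B g).
Proof.
pose good (S : set (T * U)) :=
  (forall t u, S (t, u) -> A t /\ B u) /\
  (forall t u t' u', S (t, u) -> S (t', u') -> t = t' <-> u = u').
have [F Fgood Ftot|S [[SAB Sinj] maxS]] := @Zorn_bigcup _ good.
  split=> [t u [X FX]|t u t' u' [X FX Xt] [Y FY Yt]].
    by have [+ _] := Fgood X FX; apply.
  by have [XY|YX] := Ftot X Y FX FY;
    [apply: (Fgood Y FY).2 => //; apply: XY|apply: (Fgood X FX).2 => //; apply: YX].
have [domS|/existsNP[t /not_implyP[At Nt]]] :=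
    pselect (forall t, A t -> exists u, S (t, u)).
  left; have ch t : exists u, A t -> S (t, u).
    by have [/domS[u Su]|nAt] := pselect (A t); [exists u|exists u0].
  exists (fun t => sval (cid (ch t))) => [t At|t t' /set_mem At /set_mem At'].
    by case: cid => /= u /(_ At) /SAB[].
  by case: cid => /= u /(_ At) Su; case: cid => /= u' /(_ At') Su' /(Sinj _ _ _ _ Su Su').
have [ranS|/existsNP[u /not_implyP[Bu Nu]]] :=
    pselect (forall u, B u -> exists t, S (t, u)).
  right; have ch u : exists t, B u -> S (t, u).
    by have [/ranS[t' Su]|nAt] := pselect (B u); [exists t'|exists t0].
  exists (fun u => sval (cid (ch u))) => [u Bu|u u' /set_mem Bu /set_mem Bu'].
    by case: cid => /= t' /(_ Bu) /SAB[].
  by case: cid => /= t1 /(_ Bu) Su; case: cid => /= t2 /(_ Bu') Su' /(Sinj _ _ _ _ Su Su').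
exfalso; apply: (maxS (S `|` [set (t, u)])).
  split=> [?|/(_ (t, u))]; first by left.
  by move=> /(_ (or_intror erefl)) Stu; apply: Nt; exists u.
split=> [t1 u1 [/SAB//|[-> ->]]//|t1 u1 t2 u2 [S1|[-> ->]] [S2|[-> ->]]] //.
- exact: Sinj.
- by split=> e; [case: Nt; exists u1; rewrite -e|case: Nu; exists t1; rewrite -e].
- by split=> e; [case: Nt; exists u2; rewrite e|case: Nu; exists t2; rewrite e].
Qed.

(* Zorn's lemma applied to graphs of injections [A * A -> A] extending a
   pairing function on a countable set. *)
Lemma square_inj (T : Type) (i : nat -> T) : injective i ->
  exists p : T -> T -> T, forall x y x' y', p x y = p x' y' -> x = x' /\ y = y'.
Proof.
move=> iinj.
pose dom (S : set (T * T * T)) := [set x | exists z, S (x, x, z)].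
pose good (S : set (T * T * T)) := [/\
  forall x y z, S (x, y, z) -> [/\ dom S x, dom S y & dom S z],
  forall x y, dom S x -> dom S y -> exists z, S (x, y, z) &
  forall x y z x' y' z', S (x, y, z) -> S (x', y', z') ->
    (x = x' /\ y = y') <-> z = z'].
pose S0 : set (T * T * T) :=
  [set t | exists n m : nat, t = (i n, i m, i (choice.pickle (n, m)))].
have domS0 n : dom S0 (i n) by exists (i (choice.pickle (n, n))), n, n.
have S0good : good S0.
  split=> [x y z [n [m [-> -> ->]]]|x y [_ [n [_ [-> _ _]]]] [_ [m [_ [-> _ _]]]]|].
  - by split; apply: domS0.
  - by exists (i (choice.pickle (n, m))), n, m.
  move=> _ _ _ _ _ _ [n [m [-> -> ->]]] [n' [m' [-> -> ->]]].
  split=> [[/iinj-> /iinj->]//|/iinj/(pcan_inj choice.pickleK)[-> ->]//].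
have [F Fgood Ftot|M [[Mgood M0] maxM]] :=
    @Zorn_bigcup _ (fun S => good S /\ (S !=set0 -> S0 `<=` S)).
  have dU X : F X -> dom X `<=` dom (\bigcup_(X in F) X).
    by move=> FX x [z Xz]; exists z; exists X.
  split; last first.
    by move=> [t [X FX Xt]] u S0u; exists X => //; apply: (Fgood X FX).2 => //; exists t.
  split=> [x y z [X FX Xt]|x y [z [X FX Xx]] [z' [Y FY Yy]]|].
  - have [[+ _ _] _] := Fgood X FX => /(_ _ _ _ Xt)[*].
    by split; apply: (dU X).
  - have [XY|YX] := Ftot X Y FX FY.
      have [[_ + _] _] := Fgood Y FY => /(_ x y)[||w Yw]; last by exists w, Y.
        by exists z; apply: XY.
      by exists z'.
    have [[_ + _] _] := Fgood X FX => /(_ x y)[||w Yw]; last by exists w, X.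
      by exists z.
    by exists z'; apply: YX.
  move=> x y z x' y' z' [X FX Xt] [Y FY Yt]; have [XY|YX] := Ftot X Y FX FY.
    by have [[_ _ +] _] := Fgood Y FY; apply => //; apply: XY.
  by have [[_ _ +] _] := Fgood X FX; apply => //; apply: YX.
have {}M0 : S0 `<=` M.
  have [/M0//|nM] := pselect (M !=set0); exfalso.
  apply: (maxM S0); last by split; [exact: S0good|move=> _ ?].
  split=> [t Mt|S0M]; first by case: nM; exists t.
  apply: nM; exists (i 0%N, i 0%N, i (choice.pickle (0%N, 0%N))).
  by apply: S0M; exists 0%N, 0%N.
move: Mgood => [Mdom Mtot Minj]; pose A := dom M.
have Ai n : A (i n) by have [z S0z] := domS0 n; exists z; apply: M0.
have ch x y : exists z, A x -> A y -> M (x, y, z).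
  have [Ax|] := pselect (A x); last by exists x.
  have [Ay|] := pselect (A y); last by exists y.
  by have [z Mz] := Mtot x y Ax Ay; exists z.
pose q x y := sval (cid (ch x y)).
have qM x y : A x -> A y -> M (x, y, q x y) by rewrite /q; case: cid.
have qA x y : A x -> A y -> A (q x y) by move=> Ax Ay; have /Mdom[] := qM x y Ax Ay.
have qinj x y x' y' : A x -> A y -> A x' -> A y' -> q x y = q x' y' -> x = x' /\ y = y'.
  by move=> Ax Ay Ax' Ay' /(Minj _ _ _ _ _ _ (qM _ _ Ax Ay) (qM _ _ Ax' Ay')).
have i01 : i 0%N = i 1%N -> False by move/iinj.
(* If the complement of [A] injects into [A], tagging with [i 0] and [i 1] injects [T] into [A] and
   the pairing transfers. Otherwise [g] gives a disjoint copy of [A] over which [M] extends. *)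
have [[h hA hinj]|[g gA ginj]] := set_inj_total (~` A) A (i 0%N) (i 0%N).
  pose k x := if pselect (A x) then q (i 0%N) x else q (i 1%N) (h x).
  have kA x : A (k x) by rewrite /k; case: pselect => Ax; apply: qA => //; exact: hA.
  have kinj : injective k.
    move=> x y; rewrite /k; case: pselect => Ax; case: pselect => Ay.
    - by move/(qinj _ _ _ _ (Ai _) Ax (Ai _) Ay) => [].
    - by move/(qinj _ _ _ _ (Ai _) Ax (Ai _) (hA _ Ay)) => [/i01].
    - by move/(qinj _ _ _ _ (Ai _) (hA _ Ax) (Ai _) Ay) => [/esym/i01].
    - move/(qinj _ _ _ _ (Ai _) (hA _ Ax) (Ai _) (hA _ Ay)) => [_].
      by apply: hinj; apply: mem_set.
  exists (fun x y => q (k x) (k y)) => x y x' y'.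
  by move=> /(qinj _ _ _ _ (kA _) (kA _) (kA _) (kA _))[/kinj-> /kinj->].
pose A' := A `|` g @` A.
have chg x : exists a, (g @` A) x -> A a /\ g a = x.
  by have [[a Aa <-]|nx] := pselect ((g @` A) x); [exists a|exists x].
pose gi x := sval (cid (chg x)).
have giP x : (g @` A) x -> A (gi x) /\ g (gi x) = x by rewrite /gi; case: cid.
pose j x := if pselect (A x) then q (i 0%N) x else q (i 1%N) (gi x).
have jA x : A' x -> A (j x).
  rewrite /j; case: pselect => Ax A'x; apply: qA => //.
  by apply: (giP _ _).1; case: A'x.
have jinj x y : A' x -> A' y -> j x = j y -> x = y.
  rewrite /j; case: pselect => Ax; case: pselect => Ay A'x A'y.
  - by move/(qinj _ _ _ _ (Ai _) Ax (Ai _) Ay) => [].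
  - case: A'y => // /giP[Agy _].
    by move/(qinj _ _ _ _ (Ai _) Ax (Ai _) Agy) => [/i01].
  - case: A'x => // /giP[Agx _].
    by move/(qinj _ _ _ _ (Ai _) Agx (Ai _) Ay) => [/esym/i01].
  - case: A'x => // /giP[Agx gx]; case: A'y => // /giP[Agy gy].
    by move/(qinj _ _ _ _ (Ai _) Agx (Ai _) Agy) => [_ e]; rewrite -gx -gy e.
pose N : set (T * T * T) := [set t | [/\ A' t.1.1, A' t.1.2, ~ (A t.1.1 /\ A t.1.2) &
   t.2 = g (q (j t.1.1) (j t.1.2))]].
have Nz x y z : N (x, y, z) -> (g @` A) z.
  by move=> [/= A'x A'y _ ->]; exists (q (j x) (j y)) => //; apply: qA; apply: jA.
have gNA x : (g @` A) x -> ~ A x by move=> [a Aa <-]; apply: gA.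
have domN : dom (M `|` N) = A'.
  apply/seteqP; split=> [x [z [Mx|[]//]]|x A'x]; first by left; exists z.
  have [[z Mz]|nAx] := pselect (A x); first by exists z; left.
  by exists (g (q (j x) (j x))); right; split => //= -[].
exfalso; apply: (maxM (M `|` N)).
  split=> [?|NM]; first by left.
  have gi0 : (g @` A) (g (i 0%N)) by exists (i 0%N).
  apply: (gNA _ gi0); exists (g (q (j (g (i 0%N))) (j (g (i 0%N))))).
  apply: NM; right; split => //=; try by right.
  by move=> [+ _]; apply: gNA.
split; last by move=> _ ? /M0; left.
rewrite /good domN; split.
- move=> x y z [/Mdom[? ? ?]|Nxy]; first by split; left.
  by have := Nz _ _ _ Nxy; case: Nxy => *; split => //; right.
- move=> x y A'x A'y; have [[Ax Ay]|nA] := pselect (A x /\ A y).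
    by exists (q x y); left; apply: qM.
  by exists (g (q (j x) (j y))); right.
move=> x y z x' y' z' [Mt|Nt] [Mt'|Nt'].
- exact: Minj.
- have [Ax Ay Az] := Mdom _ _ _ Mt; have := Nz _ _ _ Nt'.
  case: Nt' => /= _ _ nA _ gz; split=> [[? ?]|zz']; first by subst; case: nA.
  by subst; have := gNA _ gz.
- have [Ax Ay Az] := Mdom _ _ _ Mt'; have := Nz _ _ _ Nt.
  case: Nt => /= _ _ nA _ gz; split=> [[? ?]|zz']; first by subst; case: nA.
  by subst; have := gNA _ gz.
- case: Nt => /= A1 A2 _ ->; case: Nt' => /= A3 A4 _ ->.
  split=> [[-> ->]//|/ginj e].
  have /(qinj _ _ _ _ (jA _ A1) (jA _ A2) (jA _ A3) (jA _ A4)) :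
      q (j x) (j y) = q (j x') (j y').
    by apply: e; apply: mem_set; apply: qA; apply: jA.
  by move=> [/jinj-> // /jinj->].
Qed.

(** * A lambda-set of given size *)

Lemma card_leT_inj (T U : Type) : [set: T] #<= [set: U] ->
  exists f : T -> U, injective f.
Proof.
move=> /card_leP[f].
exists (fun x : T => val (f (SigSub (mem_set (I : setT x))))) => x y.
by move=> /val_inj /(@inj _ _ _ f) e; have := e (mem_set I) (mem_set I) => -[].
Qed.

Lemma well_founded_order (T : Type) : exists lt : T -> T -> Prop,
  well_founded lt /\ forall x y, [\/ x = y, lt x y | lt y x].
Proof.
elim/Peq: T => T; have [le wo] := well_ordering_principle T.
have lewo : wo_chain le predT by move=> A _; exact: wo.
have le_anti x y : le x y -> le y x -> x = y.
  by move=> xy yx; apply: (wo_chain_antisymmetric lewo) => //; rewrite xy yx.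
exists (fun x y => le x y /\ x <> y); split=> [x|x y]; last first.
  have [->|xy] := pselect (x = y); first by constructor 1.
  have /orP[xy'|yx'] := wo_chainW lewo (erefl : x \in predT) (erefl : y \in predT).
    by constructor 2.
  by constructor 3; split => //; exact/nesym.
apply: contrapT => nax.
have [|m [[/asboolP nam mmin] _]] :=
    wo [pred x | `[< ~ Acc (fun x y => le x y /\ x <> y) x >]].
  by exists x; apply/asboolP.
apply: nam; constructor => y [ym yneq]; apply: contrapT => nay.
by apply: yneq; apply: le_anti => //; apply: mmin; apply/asboolP.
Qed.

(* If a well-order of [K] has an initial segment supporting an unbounded family,
   then [K] injects into the least such segment. *)
Lemma bounding_order (K : Type) : [set: K] #<= [set: bounding_number] ->
  exists lt : K -> K -> Prop, [/\ well_founded lt,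
    forall x y, [\/ x = y, lt x y | lt y x] &
    forall a (F : K -> nat -> nat),
      exists g, forall b, lt b a -> eventually_le (F b) g].
Proof.
move=> Kb; have [lt [ltwf lttot]] := well_founded_order K.
pose small a := forall F : K -> nat -> nat,
  exists g, forall b, lt b a -> eventually_le (F b) g.
have [|/existsNP[a0 na0]] := pselect (forall a, small a); first by exists lt.
have [a [/existsNP[F Funb] amin]] : exists a, ~ small a /\ forall b, lt b a -> small b.
  elim/(well_founded_ind ltwf): a0 na0 => a0 IH na0.
  have [|/existsNP[b /not_implyP[ba nb]]] := pselect (forall b, lt b a0 -> small b).
    by exists a0.
  exact: (IH b).
(* [V] is unbounded, so [K] injects into it through the bounding number; choosing indices embeds [K]
   in the segment below [a]. *)
pose V := F @` [set b | lt b a].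
have bV : [set: bounding_number] #<= [set: {x | x \in V}].
  rewrite /bounding_number; case: cid => /= k [_]; apply.
  exists V; split; last exact: card_setT.
  by move=> [g Fg]; apply: Funb; exists g => b ba; apply: Fg; exists b.
have [j jinj] := card_leT_inj (card_le_trans Kb bV).
have /choice[h hP] x : exists b, lt b a /\ F b = val (j x).
  by have [b ba Fb] := set_valP (j x); exists b.
have hinj : injective h.
  by move=> x y hxy; apply/jinj/val_inj; rewrite /= -(hP x).2 hxy (hP y).2.
exists (fun x y => lt (h x) (h y)); split.
- exact: Inverse_Image.wf_inverse_image.
- move=> x y; have [/hinj|xy|yx] := lttot (h x) (h y).
  + by constructor 1.
  + by constructor 2.
  + by constructor 3.
(* The family [G] is transported along [h] to the segment, where minimality of [a] bounds it below
   [h x]. *)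
move=> x G; have /choice[G' G'P] b : exists g, forall y, h y = b -> g = G y.
  have [[y <-]|nb] := pselect (exists y, h y = b).
    by exists (G y) => z /hinj ->.
  by exists (fun=> 0%N) => y yb; case: nb; exists y.
have [g gP] := amin _ (hP x).1 G'.
by exists g => y yx; rewrite -(G'P _ y erefl); exact: gP.
Qed.

Definition eventually_lt (f g : nat -> nat) : Prop :=
  exists N, forall n, (N <= n)%N -> (f n < g n)%N.

(** Well-founded recursion bounds the earlier members, extended by zero to all of [K]; the successor
    makes the domination strict. *)
Lemma increasing_family (K : Type) (lt : K -> K -> Prop) : well_founded lt ->
  (forall a (F : K -> nat -> nat),
      exists g, forall b, lt b a -> eventually_le (F b) g) ->
  exists f : K -> nat -> nat, forall a b, lt b a -> eventually_lt (f b) (f a).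
Proof.
move=> ltwf ltb.
pose ext a (rec : forall b, lt b a -> nat -> nat) b :=
  if pselect (lt b a) is left ba then rec b ba else fun=> 0%N.
pose step a rec := fun n => (sval (cid (ltb a (ext a rec))) n).+1.
pose f := Fix ltwf (fun=> nat -> nat) step.
have fE a : f a = step a (fun b _ => f b).
  rewrite /f Fix_eq// => x r r' rr'; congr step.
  by apply: functional_extensionality_dep => y; apply: functional_extensionality_dep.
exists f => a b ba; rewrite (fE a) /step; case: cid => /= g /(_ b ba)[N _ gN].
exists N => n /gN /=; rewrite /ext; case: pselect => // _.
Qed.

(** The diagonal bound at [m] is the maximum of the first [m + 1] bounds, so it dominates the [n]-th
    one from [n] on. *)
Lemma eventually_le_bigcup (K : Type) (S : nat -> set K) (F : K -> nat -> nat) :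
  (forall n, exists g, forall b, S n b -> eventually_le (F b) g) ->
  exists g, forall b n, S n b -> eventually_le (F b) g.
Proof.
move=> /choice[g gP]; exists (fun m => \max_(n < m.+1) g n m)%N => b n Snb.
have [N _ NP] := gP n b Snb; exists (maxn N n) => // m /=; rewrite geq_max.
move=> /andP[Nm nm]; apply: (leq_trans (NP m Nm)).
by rewrite -ltnS in nm; exact: (leq_bigmax (Ordinal nm)).
Qed.

Definition agree (n : nat) (f g : nat -> nat) : Prop :=
  forall i, (i < n)%N -> f i = g i.

(* The topology on [K] is the one pulled back from the Baire space along [f];
   [Z] exhibits the complement of the countable set [c] as an F_sigma set. *)
Definition lambda_set (K : Type) (f : K -> nat -> nat) : Prop :=
  forall c : nat -> K, exists Z : nat -> set K,
    (forall m x, ~ Z m x -> exists n, forall y, agree n (f x) (f y) -> ~ Z m y) /\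
    forall x, (exists m, Z m x) <-> (forall n, c n <> x).

Lemma agreeS n m f g : (n <= m)%N -> agree m f g -> agree n f g.
Proof. by move=> nm fg i /leq_trans-/(_ _ nm)/fg. Qed.

Lemma agreeP f g : (forall n, agree n f g) -> f = g.
Proof. by move=> fg; apply/funext => i; apply: (fg i.+1). Qed.

(* The points of [c] are enumerated with infinite repetition, so that a set
   avoiding the cylinders around almost all terms contains no point of [c]. *)
Lemma separate_bounded (K : Type) (f : K -> nat -> nat) (c : nat -> K) (S : set K) :
  injective f ->
  (forall F : K -> nat -> nat, exists g, forall b, S b -> eventually_le (F b) g) ->
  exists Z : nat -> set K,
    [/\ forall m x, ~ Z m x -> exists n, forall y, agree n (f x) (f y) -> ~ Z m y,
      forall x, S x -> (forall n, c n <> x) -> exists m, Z m x &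
      forall m n, ~ Z m (c n)].
Proof.
move=> finj Sb; pose c' n := c (odflt (0%N, 0%N) (choice.unpickle n)).1.
have c'P n m : exists2 k, (m <= k)%N & c' k = c n.
  have [[k mk ck]|nk] := pselect (exists2 k, (m <= k)%N & c' k = c n).
    by exists k.
  (* Pigeonhole: if [c n] recurred only below [m], the codes of the [m + 1] pairs [(n, k)] with
     [k <= m] would all lie below [m]. *)
  have pm (k : nat) : (choice.pickle (n, k) < m)%N.
    rewrite ltnNge; apply/negP => mk; apply: nk; exists (choice.pickle (n, k)) => //.
    by rewrite /c' choice.pickleK.
  pose e (k : 'I_m.+1) := Ordinal (pm k).
  have /leq_card : injective e.
    by move=> k k' [/(pcan_inj choice.pickleK)[/ord_inj]].
  by rewrite !card_ord ltnn.
have sep x n : exists k, c' n <> x -> ~ agree k (f x) (f (c' n)).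
  have [->|ne] := pselect (c' n = x); first by exists 0%N.
  have [k nk] : exists k, ~ agree k (f x) (f (c' n)).
    by apply/existsNP => /agreeP/finj/esym.
  by exists k.
pose F x n := sval (cid (sep x n)).
have FP x n : c' n <> x -> ~ agree (F x n) (f x) (f (c' n)) by rewrite /F; case: cid.
have [g gP] := Sb F.
(* Removing open cylinders leaves a closed set, which keeps every [x] off [c] such that
   [F x n <= g n] for all [n >= m]. *)
exists (fun m => [set x | forall n, (m <= n)%N -> ~ agree (g n) (f x) (f (c' n))]).
split.
- move=> m x /existsNP[n /not_implyP[mn /contrapT ag]].
  exists (g n) => y xy /(_ n mn); apply => i ig.
  by rewrite -xy// ag.
- move=> x Sx nx; have [N _ NP] := gP x Sx; exists N => n Nn ag.
  by apply: (FP x n); [exact: nx|exact: agreeS (NP n Nn) ag].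
- by move=> m n; have [k mk ck] := c'P n m; move=> /(_ k mk); rewrite ck; apply.
Qed.

Lemma lambda_set_exists (K : Type) : [set: K] #<= [set: bounding_number] ->
  exists f : K -> nat -> nat, injective f /\ lambda_set f.
Proof.
move=> /bounding_order[lt [ltwf lttot ltb]].
have [f finc] := increasing_family ltwf ltb; exists f.
have finj : injective f.
  have ltirr g : eventually_lt g g -> False.
    by move=> [N /(_ N (leqnn N))]; rewrite ltnn.
  move=> x y fxy; have [//|/finc|/finc] := lttot x y; rewrite fxy; by move/ltirr.
split=> // c.
have [[a ca]|unb] := pselect (exists a, forall n, lt (c n) a).
  have [Z [Zcl Zc Zd]] := separate_bounded c finj (ltb a).
  (* Together the [Y m] catch [a] and all members above it; no [c n] is caught, as [f (c n)] is
     eventually strictly below [f a]. *)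
  pose Y m := [set x | forall i, (m <= i)%N -> (f a i <= f x i)%N].
  exists (fun m => Z m `|` Y m); split=> [m x /not_orP[/Zcl[n nP]]|x].
    move=> /existsNP[i /not_implyP[mi /negP]]; rewrite -ltnNge => ltf.
    exists (maxn n i.+1) => y xy [|/(_ i mi)].
      by apply: nP; apply: agreeS xy; rewrite leq_maxl.
    by rewrite leqNgt -(xy i) ?ltf// leq_maxr.
  split=> [[m [Zmx|Yx]] n cx|nc].
  - by apply: (Zd m n); rewrite cx.
  - have [N NP] := finc _ _ (ca n); have := NP _ (leq_maxl N m).
    by rewrite ltnNge cx Yx// leq_maxr.
  have [xa|ax|ax] := lttot x a.
  - by exists 0%N; right=> i _; rewrite xa.
  - by have [m Zm] := Zc x ax nc; exists m; left.
  - by have [N NP] := finc _ _ ax; exists N; right=> i /NP/ltnW.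
(* If [c] is unbounded, every point off [c] lies below some term, and families on a countable union
   of initial segments are still bounded. *)
have [F|Z [Zcl Zc Zd]] := @separate_bounded _ f c [set x | exists n, lt x (c n)] finj.
  have [g gP] := eventually_le_bigcup (S := fun n => [set x | lt x (c n)]) (fun n => ltb (c n) F).
  by exists g => b [n] /gP.
exists Z; split=> // x; split=> [[m Zm] n cx|nc]; first by apply: (Zd m n); rewrite cx.
apply: Zc => //; apply: contrapT => nx; apply: unb; exists x => n.
have [/nc//|//|xc] := lttot (c n) x.
by case: nx; exists n.
Qed.

(** * The back-and-forth construction *)

(** An ultrametric without real numbers: [E n] will be the relation of being at distance less than
    [1/(n+1)]. *)
Record ultra (T : Type) (E : nat -> T -> T -> Prop) : Prop := Ultra {
  ultra_refl : forall n x, E n x x;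
  ultra_sym : forall n x y, E n x y -> E n y x;
  ultra_trans : forall n y x z, E n x y -> E n y z -> E n x z;
  ultra_le : forall n m x y, (n <= m)%N -> E m x y -> E n x y;
  ultra0 : forall x y, E 0%N x y }.

Section Ultra.
Variables (T : Type) (E : nat -> T -> T -> Prop).
Hypothesis uE : ultra E.

Definition uopen (U : set T) :=
  forall x, U x -> exists n, forall y, E n x y -> U y.

Definition uclosed (A : set T) := uopen (~` A).

Definition uclopen (U : set T) := uopen U /\ uclosed U.

Definition ucontinuous (f : T -> T) :=
  forall x k, exists l, forall y, E l x y -> E k (f x) (f y).

Lemma uopenI U V : uopen U -> uopen V -> uopen (U `&` V).
Proof.
move=> Uo Vo x [/Uo[n nU] /Vo[m mV]]; exists (maxn n m) => y xy.
by split; [apply: nU|apply: mV]; apply: (ultra_le uE _ xy); rewrite ?leq_maxl ?leq_maxr.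
Qed.

Lemma uopenU U V : uopen U -> uopen V -> uopen (U `|` V).
Proof.
move=> Uo Vo x [/Uo[n nU]|/Vo[n nV]]; exists n => y xy.
  by left; apply: nU.
by right; apply: nV.
Qed.

Lemma uclosedI U V : uclosed U -> uclosed V -> uclosed (U `&` V).
Proof. by rewrite /uclosed setCI; exact: uopenU. Qed.

Lemma uclopenI U V : uclopen U -> uclopen V -> uclopen (U `&` V).
Proof. by move=> [? ?] [? ?]; split; [exact: uopenI|exact: uclosedI]. Qed.

Lemma uclopenC U : uclopen U -> uclopen (~` U).
Proof. by move=> [Uo Uc]; split=> //; rewrite /uclosed setCK. Qed.

Definition uretraction (A : set T) (r : T -> T) :=
  [/\ forall x, A (r x), forall x, A x -> r x = x & ucontinuous r].

(* A point off [A] goes to a choice among the points of [A] that agree with it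
   to the largest possible level. *)
Lemma uretraction_exists (A : set T) : uclosed A -> A !=set0 ->
  exists r, uretraction A r.
Proof.
move=> Acl [a0 Aa0].
have /choice[j jP] x : exists j, ~ A x ->
    (exists a, A a /\ E j x a) /\ ~ exists a, A a /\ E j.+1 x a.
  have [Ax|/[dup] nAx /Acl[n nP]] := pselect (A x); first by exists 0%N.
  have exn : exists n, `[< ~ exists a, A a /\ E n x a >].
    by exists n; apply/asboolP => -[a [Aa /nP]].
  case: (ex_minnP exn) => -[/asboolP[]|m /asboolP nm mmin].
    by exists a0; split=> //; exact: (ultra0 uE _ _).
  exists m => _; split=> //; apply: contrapT => H.
  by have /mmin : `[< ~ exists a, A a /\ E m x a >]; [exact/asboolP|rewrite ltnn].
pose S x := [set a | A a /\ E (j x) x a].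
(* The choice depends only on the set, so equal candidate sets give equal images; this makes [r]
   locally constant off [A]. *)
pose pick (B : set T) := if pselect (exists a, B a) is left e then sval (cid e) else a0.
pose r x := if pselect (A x) then x else pick (S x).
have rS x : ~ A x -> S x (r x).
  move=> nAx; rewrite /r; case: pselect => // b; rewrite /pick.
  by case: pselect => [e|ne]; [exact: (svalP (cid e))|exfalso; apply: ne; have [] := jP x nAx].
have rid x : A x -> r x = x by rewrite /r; case: pselect.
have Sj x n a : ~ A x -> A a -> E n x a -> (n <= j x)%N.
  move=> nAx Aa xa; rewrite leqNgt; apply/negP => jn.
  by apply: (jP x nAx).2; exists a; split=> //; exact: (ultra_le uE jn xa).
exists r; split=> [x|//|x k].
  by have [Ax|/rS[]//] := pselect (A x); rewrite rid.
have [Ax|nAx] := pselect (A x).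
  exists k => y xy; rewrite rid//.
  have [Ay|nAy] := pselect (A y); first by rewrite rid.
  apply: (ultra_trans uE xy); have [_] := rS y nAy; apply: (ultra_le uE).
  by apply: (Sj y k x) => //; exact: (ultra_sym uE xy).
have [n nP] := Acl x nAx.
have [[a [Aa xa]] nj] := jP x nAx.
exists (maxn n (j x).+1) => y xy.
have nAy : ~ A y by apply: nP; apply: (ultra_le uE _ xy); rewrite leq_maxl.
have {}xy : E (j x).+1 x y by apply: (ultra_le uE _ xy); rewrite leq_maxr.
have xy' : E (j x) x y by apply: (ultra_le uE _ xy).
have jj : j y = j x.
  apply/eqP; rewrite eqn_leq; apply/andP; split; last first.
    by apply: (Sj y _ a) => //; apply: (ultra_trans uE) xa; exact: (ultra_sym uE xy').
  rewrite leqNgt; apply/negP => lt; apply: nj.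
  have [[b [Ab yb]] _] := jP y nAy; exists b; split=> //.
  by apply: (ultra_trans uE xy); exact: (ultra_le uE lt yb).
have -> : r y = r x; last exact: (ultra_refl uE _ _).
rewrite /r; case: pselect => // ?; case: pselect => // ?; congr pick.
apply/seteqP; rewrite /S jj; split=> b [Ab yb]; split=> //.
  exact: (ultra_trans uE xy').
by apply: (ultra_trans uE) yb; exact: (ultra_sym uE xy').
Qed.

End Ultra.

(* Side [true] of a graph is its domain, side [false] its range. *)
Definition gside (T : Type) (b : bool) (G : T -> T -> Prop) : T -> T -> Prop :=
  if b then G else fun y x => G x y.

Definition gdom (T : Type) (G : T -> T -> Prop) : set T :=
  [set x | exists y, G x y].

(** The conditions are one-sided. Imposed on both sides of a graph, they make it a homeomorphism
    between closed nowhere dense sets that respects [D] and [D'] in both directions. *)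
Record pmap (T : Type) (E : nat -> T -> T -> Prop) (D D' U : set T)
    (G : T -> T -> Prop) : Prop := Pmap {
  pmap_sub : forall x y, G x y -> U x;
  pmap_fun : forall x y y', G x y -> G x y' -> y = y';
  pmap_closed : uclosed E (gdom G);
  pmap_cont : forall x y k, G x y ->
    exists l, forall x' y', G x' y' -> E l x x' -> E k y y';
  pmap_thin : forall x y n, G x y -> exists x', E n x x' /\ ~ gdom G x';
  pmap_base : forall x y, G x y -> D x -> D' y }.

(** * Refining matched clopen partitions and passing to the limit *)

Section BackAndForth.
Variables (T : Type) (E : nat -> T -> T -> Prop).
Hypothesis uE : ultra E.
Variables (D : bool -> set T) (K : bool -> nat -> set T).
Hypothesis K_cover : forall b x, exists c, K b c x.
Variable x0 : T.

(** Task [c] asks that the part of [K b c] inside [U b] be covered on each side [b]; [up c U] is a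
    graph that does so. *)
Variable up : nat -> (bool -> set T) -> T -> T -> Prop.
Hypothesis upP : forall c (U : bool -> set T),
  (forall b, uclopen E (U b) /\ U b !=set0) ->
  forall b, pmap E (D b) (D (~~ b)) (U b) (gside b (up c U)) /\
            K b c `&` U b `<=` gdom (gside b (up c U)).

Variable ret : set T -> T -> T.
Hypothesis retP : forall A, uclosed E A -> A !=set0 -> uretraction E A (ret A).

(* The [graph] of a piece is a homeomorphism between closed nowhere dense subsets
   of [carrier true] and [carrier false]. The [stage] counts the tasks attempted
   so far; it advances only when the graph is empty. *)
Record piece := Piece {
  carrier : bool -> set T; graph : T -> T -> Prop; stage : nat }.

Definition pgood (p : piece) := forall b,
  [/\ uclopen E (carrier p b), carrier p b !=set0 &
      pmap E (D b) (D (~~ b)) (carrier p b) (gside b (graph p))].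

Definition active (p : piece) := exists x y, graph p x y.

Definition off (p : piece) k b :=
  [set x | carrier p b x /\ ~ E k x (ret (gdom (gside b (graph p))) x)].

(* Chosen so large that the rest is nonempty on both sides: matched clopen sets
   must never have one side empty. *)
Definition level n p :=
  get [set k | (n <= k)%N /\ forall b, off p k b !=set0].

(** Both coordinates are restricted, so that a piece becomes small on its two sides at once; this
    yields continuity in both directions. *)
Definition near_graph k (a : bool -> T) (G : T -> T -> Prop) x y :=
  [/\ G x y, E k x (a true) & E k y (a false)].

Definition near_piece k a p :=
  let G := near_graph k a (graph p) in
  Piece (fun b => [set x | [/\ carrier p b x,
      E k x (ret (gdom (gside b (graph p))) x) &
      gdom (gside b G) (ret (gdom (gside b (graph p))) x)]]) G (stage p).

Definition rest_piece k p := Piece (off p k) (fun _ _ => False) (stage p).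

Definition up_piece p :=
  Piece (carrier p) (up (stage p) (carrier p)) (stage p).+1.

Definition child n p q :=
  (~ active p /\ q = up_piece p) \/
  (active p /\ (q = rest_piece (level n p) p \/
     exists a, graph p (a true) (a false) /\ q = near_piece (level n p) a p)).

Lemma active_side b p : active p -> gdom (gside b (graph p)) !=set0.
Proof. by move=> [x [y Gxy]]; case: b; [exists x, y|exists y, x]. Qed.

Lemma side_active b p x y : gside b (graph p) x y -> active p.
Proof. by case: b => Gxy; [exists x, y|exists y, x]. Qed.

Lemma near_side k a G b x y : gside b (near_graph k a G) x y <->
  [/\ gside b G x y, E k x (a b) & E k y (a (~~ b))].
Proof. by case: b; split=> [[? ? ?]|[? ? ?]]; split. Qed.

Lemma ret_good p b : pgood p -> active p ->
  uretraction E (gdom (gside b (graph p))) (ret (gdom (gside b (graph p)))).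
Proof.
move=> pg pa; apply: retP; last exact: active_side.
by have [_ _ pm] := pg b; exact: (pmap_closed pm).
Qed.

Lemma uopen_near A r k : uretraction E A r -> uclopen E [set x | E k x (r x)].
Proof.
move=> [_ _ rc]; split=> x /= xr; have [l lP] := rc x k;
  exists (maxn k l) => y xy; have xky := ultra_le uE (leq_maxl k l) xy;
  have rxy := lP y (ultra_le uE (leq_maxr k l) xy).
  by apply: (ultra_trans uE (ultra_sym uE xky)); apply: (ultra_trans uE xr).
move=> yr; apply: xr; apply: (ultra_trans uE xky); apply: (ultra_trans uE yr).
exact: (ultra_sym uE rxy).
Qed.

(** Thinness gives a point of the carrier off the domain, and closedness separates it from its
    retraction at some level. As [off] grows with the level, one level serves both sides. *)
Lemma levelP n p : pgood p -> active p ->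
  (n <= level n p)%N /\ forall b, off p (level n p) b !=set0.
Proof.
move=> pg pa; apply: (@getPex _ [set k | (n <= k)%N /\ forall b, off p k b !=set0]).
have offb b : exists k, off p k b !=set0.
  have [[Uo _] _ pm] := pg b; have [a [y Gay]] := active_side b pa.
  have [l lU] := Uo a (pmap_sub pm Gay).
  have [x [ax nx]] := pmap_thin pm l Gay.
  have [k kP] := pmap_closed pm nx.
  have [rA _ _] := ret_good b pg pa.
  by exists k, x; split=> [|/kP]; [exact: lU|apply; exact: rA].
have [k0 [x0' [Ux0 off0]]] := offb true; have [k1 [x1 [Ux1 off1]]] := offb false.
exists (maxn n (maxn k0 k1)); split=> [|[]]; first exact: leq_maxl.
  exists x0'; split=> // xr; apply: off0; apply: (ultra_le uE _ xr).
  by rewrite !leq_max leqnn orbT.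
exists x1; split=> // xr; apply: off1; apply: (ultra_le uE _ xr).
by rewrite !leq_max leqnn !orbT.
Qed.

Lemma off_clopen p k b : pgood p -> active p -> uclopen E (off p k b).
Proof.
move=> pg pa; have [Uc _ _] := pg b; apply: uclopenI => //.
by apply: uclopenC; apply: (uopen_near _ (ret_good b pg pa)).
Qed.

Lemma near_good k a p : pgood p -> graph p (a true) (a false) ->
  pgood (near_piece k a p).
Proof.
move=> pg Ga b; have pa : active p by exists (a true), (a false).
have [Uc _ pm] := pg b; have ret_b := ret_good b pg pa.
have [rA rid rc] := ret_b.
have Gab : gside b (near_graph k a (graph p)) (a b) (a (~~ b)).
  by apply/near_side; split; [case: b {Uc pm ret_b rA rid rc}|exact: (ultra_refl uE _ _)..].
have gd x : gdom (gside b (near_graph k a (graph p))) x ->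
    gdom (gside b (graph p)) x by move=> [y /near_side[? _ _]]; exists y.
(* Continuity of the partial map makes the near part relatively clopen in the domain; pulling back
   along the retraction makes the carrier clopen. *)
have near_open x : gdom (gside b (near_graph k a (graph p))) x -> exists l,
    forall x', E l x x' -> gdom (gside b (graph p)) x' ->
      gdom (gside b (near_graph k a (graph p))) x'.
  move=> [y /near_side[Gxy xa yb]]; have [l lP] := pmap_cont pm k Gxy.
  exists (maxn k l) => x' xx' [y' Gx'y']; exists y'; apply/near_side; split=> //.
    apply: (ultra_trans uE) xa; apply: (ultra_sym uE).
    by apply: (ultra_le uE _ xx'); rewrite leq_maxl.
  apply: (ultra_trans uE) yb; apply: (ultra_sym uE); apply: (lP _ _ Gx'y').
  by apply: (ultra_le uE _ xx'); rewrite leq_maxr.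
have near_closed x : ~ gdom (gside b (near_graph k a (graph p))) x -> exists l,
    forall x', E l x x' -> gdom (gside b (graph p)) x' ->
      ~ gdom (gside b (near_graph k a (graph p))) x'.
  move=> nx; have [[y Gxy]|ndom] := pselect (gdom (gside b (graph p)) x); last first.
    by have [l lP] := pmap_closed pm ndom; exists l => x' /lP.
  have [l lP] := pmap_cont pm k Gxy.
  exists (maxn k l) => x' xx' _ [y' /near_side[Gx'y' x'a y'b]]; apply: nx.
  exists y; apply/near_side; split=> //.
    by apply: (ultra_trans uE) x'a; apply: (ultra_le uE _ xx'); rewrite leq_maxl.
  apply: (ultra_trans uE) y'b; apply: (lP _ _ Gx'y').
  by apply: (ultra_le uE _ xx'); rewrite leq_maxr.
split.
- have -> : carrier (near_piece k a p) b = carrier p b `&`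
      ([set x | E k x (ret (gdom (gside b (graph p))) x)] `&`
       [set x | gdom (gside b (near_graph k a (graph p)))
                     (ret (gdom (gside b (graph p))) x)]).
    by apply/seteqP; split=> x /=; [case|case=> ? []].
  apply: uclopenI => //; apply: uclopenI => //; first exact: (uopen_near _ ret_b).
  split=> x /=.
    move=> /near_open[l lP]; have [m mP] := rc x l.
    by exists m => y /mP xy; apply: lP.
  move=> /near_closed[l lP]; have [m mP] := rc x l.
  by exists m => y /mP xy; apply: lP.
- have [y dy] : gdom (gside b (graph p)) (a b) by apply: gd; exists (a (~~ b)).
  have dab : gdom (gside b (graph p)) (a b) by exists y.
  exists (a b); split=> /=.
  + exact: (pmap_sub pm dy).
  + by rewrite rid//; exact: (ultra_refl uE _ _).
  + by rewrite rid//; exists (a (~~ b)).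
split=> [x y /near_side[Gxy xa yb]|x y y' /near_side[Gxy _ _] /near_side[Gxy' _ _]||
  x y l /near_side[Gxy _ _]|x y n /near_side[Gxy _ _]|x y /near_side[Gxy _ _]].
- have dx : gdom (gside b (graph p)) x by exists y.
  split=> /=; first exact: (pmap_sub pm Gxy).
    by rewrite rid//; exact: (ultra_refl uE _ _).
  by rewrite rid//; exists y; apply/near_side.
- exact: (pmap_fun pm Gxy Gxy').
- move=> x nx; have [l lP] := near_closed x nx; exists l => y xy dy.
  exact: (lP _ xy (gd _ dy) dy).
- have [m mP] := pmap_cont pm l Gxy.
  by exists m => x' y' /near_side[Gxy' _ _]; exact: mP.
- have [x' [xx' nx']] := pmap_thin pm n Gxy.
  by exists x'; split=> // /gd.
- exact: (pmap_base pm Gxy).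
Qed.

Lemma child_good n p q : pgood p -> child n p q -> pgood q.
Proof.
move=> pg [[_ ->] b|[pa [->|[a [Ga ->]]]]]; last exact: near_good.
  have [|? ?] := @upP (stage p) (carrier p) _ b; last by have [] := pg b.
  by move=> {}b; have [] := pg b.
move=> b; have [_ /(_ b) ne] := levelP n pg pa.
split=> //; first exact: off_clopen.
have nd x : ~ gdom (@gside T b (fun _ _ => False)) x by move=> [y]; case: b {ne}.
have nG x y : ~ @gside T b (fun _ _ => False) x y by case: b {ne nd}.
split=> [x y /nG//|x y y' /nG//||x y k /nG//|x y k /nG//|x y /nG//].
by move=> x _; exists 0%N => y _; exact: nd.
Qed.

Lemma child_sub n p q b : child n p q -> carrier q b `<=` carrier p b.
Proof. by move=> [[_ ->]|[pa [->|[a [Ga ->]]]]] x //= []. Qed.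

Lemma child_cover n p b x : pgood p -> carrier p b x ->
  exists q, child n p q /\ carrier q b x.
Proof.
move=> pg px; have [pa|npa] := pselect (active p); last first.
  by exists (up_piece p); split=> //; left.
have [xr|xr] := pselect (E (level n p) x (ret (gdom (gside b (graph p))) x)).
  have [rA _ _] := ret_good b pg pa.
  have [y Gy] := rA x; set z := ret _ x in xr Gy.
  pose a (b' : bool) := if b' == b then z else y.
  exists (near_piece (level n p) a p); split.
    right; split=> //; right; exists a; split=> //; rewrite /a.
    by case: b @z xr Gy {px a rA}.
  split=> //=; exists y; apply/near_side; rewrite /a eqxx; split=> //.
    exact: (ultra_refl uE _ _).
  have -> : (~~ b == b) = false by case: (b).
  exact: (ultra_refl uE _ _).
by exists (rest_piece (level n p) p); split=> //; right; split=> //; left.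
Qed.

(** Two near pieces sharing [x] share the pair formed by the retraction of [x] and its partner.
    Their centers are then [E k] related in both coordinates, so the two near graphs are equal. *)
Lemma child_inj n p q q' b x : pgood p -> child n p q -> child n p q' ->
  carrier q b x -> carrier q' b x -> q = q'.
Proof.
move=> pg [[npa ->]|[pa c]] [[npa' ->]|[pa' c']] //.
case: c => [->|[a [Ga ->]]]; case: c' => [->|[a' [Ga' ->]]] //=.
- by move=> [_ nr] [_ /nr].
- by move=> [_ r _] [_ /(_ r)].
move=> [_ _ [y /near_side[Gy ya yb]]] [_ _ [y' /near_side[Gy' ya' yb']]].
have [_ _ pm] := pg b; have eyy' := pmap_fun pm Gy Gy'; subst y'.
set k := level n p in ya yb ya' yb' *.
have Ea : E k (a b) (a' b) by apply: (ultra_trans uE) ya'; exact: (ultra_sym uE ya).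
have Eb : E k (a (~~ b)) (a' (~~ b)).
  by apply: (ultra_trans uE) yb'; exact: (ultra_sym uE yb).
have Eall c : E k (a c) (a' c) by case: b c Ea Eb {ya yb ya' yb' Gy Gy' pm} => -[].
rewrite /near_piece; suff -> : near_graph k a (graph p) = near_graph k a' (graph p) by [].
apply/funext => u; apply/funext => v; apply/propext; split=> -[Guv ua va]; split=> //.
- exact: (ultra_trans uE ua (Eall _)).
- exact: (ultra_trans uE va (Eall _)).
- exact: (ultra_trans uE ua (ultra_sym uE (Eall _))).
- exact: (ultra_trans uE va (ultra_sym uE (Eall _))).
Qed.

(** The near piece is centered at the given pair: its points are close to their retractions, and
    these are close to the center. *)
Lemma child_graph n p b x y : pgood p -> gside b (graph p) x y ->
  exists q, [/\ child n p q, gside b (graph q) x y,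
    forall x', carrier q b x' -> E n x x' &
    forall y', carrier q (~~ b) y' -> E n y y'].
Proof.
move=> pg Gxy; have pa := side_active Gxy.
have [nl _] := levelP n pg pa; set k := level n p in nl.
pose a (b' : bool) := if b' == b then x else y.
have ab : a b = x by rewrite /a eqxx.
have anb : a (~~ b) = y by rewrite /a; case: (b).
exists (near_piece k a p); split.
- right; split=> //; right; exists a; split=> //.
  by case: b Gxy @a ab anb.
- by apply/near_side; rewrite ab anb; split=> //; exact: (ultra_refl uE _ _).
- move=> x' /= [_ x'r [z /near_side[_ ra _]]]; apply: (ultra_le uE nl).
  rewrite ab in ra; apply: (ultra_sym uE); exact: (ultra_trans uE x'r ra).
move=> x' /= [_ x'r [z /near_side[_ ra _]]]; apply: (ultra_le uE nl).
rewrite anb in ra; apply: (ultra_sym uE); exact: (ultra_trans uE x'r ra).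
Qed.

Fixpoint pieces n : set piece :=
  if n is n'.+1 then [set q | exists2 p, pieces n' p & child n' p q]
  else [set Piece (fun=> setT) (fun _ _ => False) 0].

Lemma pieces_good n p : pieces n p -> pgood p.
Proof.
elim: n p => [_ -> b|n IH p [q /IH qg]]; last exact: child_good.
split; last split.
- by split=> [x _|x /(_ I)//]; exists 0%N.
- by exists x0.
- by [].
- by case: b.
- by move=> x _; exists 0%N => y _ [z]; case: b.
- by case: b.
- by case: b.
- by case: b.
Qed.

Lemma pieces_inj n b x p q : pieces n p -> pieces n q ->
  carrier p b x -> carrier q b x -> p = q.
Proof.
elim: n p q => [|n IH] p q; first by move=> -> ->.
move=> [p' np' pp'] [q' nq' qq'] px qx.
have pq' := IH _ _ np' nq' (child_sub pp' px) (child_sub qq' qx); subst q'.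
exact: (child_inj (pieces_good np') pp' qq' px qx).
Qed.

Lemma pieces_graph n m b p x y : pieces n p -> gside b (graph p) x y ->
  (n <= m)%N -> exists2 q, pieces m q & gside b (graph q) x y.
Proof.
move=> np Gxy; elim: m => [|m IH]; first by rewrite leqn0 => /eqP n0; exists p; rewrite -?n0.
rewrite leq_eqVlt => /predU1P[<-|]; first by exists p.
rewrite ltnS => /IH[q mq qxy].
have [q' [qq' ? _ _]] := child_graph m (pieces_good mq) qxy.
by exists q' => //; exists q.
Qed.

Lemma pieces_ancestor n m q : (n <= m)%N -> pieces m q ->
  exists2 p, pieces n p & forall b, carrier q b `<=` carrier p b.
Proof.
elim: m q => [|m IH] q; first by rewrite leqn0 => /eqP-> q0; exists q => // b x.
rewrite leq_eqVlt => /predU1P[<-|]; first by exists q => // b x.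
rewrite ltnS => /IH{}IH [q' /IH[p np qp] q'q]; exists p => // b.
by move=> x /(child_sub q'q)/qp.
Qed.

Definition limit_graph x y := exists n p, pieces n p /\ graph p x y.

Lemma limit_side b x y : gside b limit_graph x y <->
  exists n p, pieces n p /\ gside b (graph p) x y.
Proof. by case: b. Qed.

Lemma graph_sub n p b x y : pieces n p -> gside b (graph p) x y -> carrier p b x.
Proof. by move=> /pieces_good/(_ b)[_ _ pm]; exact: (pmap_sub pm). Qed.

(** Both pairs persist to a common level, where the two pieces share [x] and hence coincide. *)
Lemma limit_fun b x y y' :
  gside b limit_graph x y -> gside b limit_graph x y' -> y = y'.
Proof.
move=> /limit_side[n [p [np pxy]]] /limit_side[m [q [mq qxy]]].
have [p' np' p'xy] := pieces_graph np pxy (leq_maxl n m).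
have [q' nq' q'xy] := pieces_graph mq qxy (leq_maxr n m).
have pq := pieces_inj np' nq' (graph_sub np' p'xy) (graph_sub nq' q'xy); subst q'.
by have [_ _ pm] := pieces_good np' b; exact: (pmap_fun pm p'xy q'xy).
Qed.

(* A point staying forever in pieces with nonempty graph is a limit of points
   of the domain of the first of these graphs, which is closed. *)
Lemma leave_active n p b x : pieces n p -> carrier p b x -> active p ->
  ~ gdom (gside b limit_graph) x -> exists m q,
    [/\ pieces m q, carrier q b x, ~ active q & stage q = stage p].
Proof.
move=> np px pa ndom; apply: contrapT => stay; apply: ndom.
have pg := pieces_good np b; case: pg => _ _ pm.
suff [y Gxy] : gdom (gside b (graph p)) x.
  by exists y; apply/limit_side; exists n, p.
apply: contrapT => /(pmap_closed pm)[k kP].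
have : exists q, [/\ pieces (n + k).+1 q, carrier q b x, active q & stage q = stage p] /\
   ((forall u v, gside b (graph q) u v -> gside b (graph p) u v) /\
   exists a, gdom (gside b (graph q)) a /\ E (n + k) x a).
  (* The rest piece is inactive with the same stage, which [stay] excludes; so the child containing
     [x] is a near piece. *)
  have step m q : pieces m q -> carrier q b x -> active q -> stage q = stage p ->
     exists q', [/\ pieces m.+1 q', carrier q' b x, active q' & stage q' = stage p] /\
     ((forall u v, gside b (graph q') u v -> gside b (graph q) u v) /\
     exists a, gdom (gside b (graph q')) a /\ E m x a).
    move=> mq qx qa qs; have qg := pieces_good mq.
    have [q' [qq' q'x]] := child_cover m qg qx.
    have mq' : pieces m.+1 q' by exists q.
    exists q'; case: qq' => [[]//|[_ [q'E|[a [Ga q'E]]]]].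
      by case: stay; exists m.+1, q'; split=> //; rewrite q'E // => -[? [? []]].
    have [lm _] := levelP m qg qa.
    rewrite q'E in q'x *; case: q'x => /= cx xr dr; split; last split.
    - split=> //; first by rewrite -q'E.
      have [y dy] := dr.
      exact: (@side_active b (near_piece (level m q) a q) _ _ dy).
    - by move=> u v /near_side[].
    - by exists (ret (gdom (gside b (graph q))) x); split=> //; exact: (ultra_le uE lm xr).
  elim: k {kP} => [|k [q [[mq qx qa qs] [qp _]]]].
    by rewrite addn0; exact: step.
  have [q' [? [qq' ?]]] := step _ q mq qx qa qs.
  by exists q'; rewrite addnS; split=> //; split=> // u v /qq' /qp.
move=> [q [_ [qp [a [[v /qp Gav] xa]]]]].
apply: (kP a); last by exists v.
by apply: (ultra_le uE _ xa); rewrite leq_addl.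
Qed.

(** An uncovered point would leave every nonempty graph and so reach an inactive piece at each
    stage, in particular at a stage [c] with [K b c x], where [up] covers it. *)
Lemma limit_total b x : gdom (gside b limit_graph) x.
Proof.
apply: contrapT => ndom.
have wait c : exists n p, [/\ pieces n p, carrier p b x, ~ active p & stage p = c].
  elim: c => [|c [n [p [np px npa pc]]]].
    by exists 0%N; eexists; split; [reflexivity|..] => // -[? [? []]].
  have nq : pieces n.+1 (up_piece p) by exists p => //; left.
  have [qa|nqa] := pselect (active (up_piece p)); last first.
    by exists n.+1, (up_piece p); split=> //=; rewrite pc.
  have [m [q [? ? ? qE]]] := leave_active nq px qa ndom.
  by exists m, q; split=> //; rewrite qE /= pc.
have [c Kx] := K_cover b x; have [n [p [np px npa pc]]] := wait c.
apply: ndom; have pg := pieces_good np.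
have [|_ /(_ x)] := @upP c (carrier p) _ b; first by move=> b'; have [] := pg b'.
case=> // y Gxy; exists y; apply/limit_side; exists n.+1, (up_piece p).
by split; [exists p => //; left|rewrite /= pc].
Qed.

(** A small piece around the pair has an open carrier. Later pairs starting in that carrier belong
    to its descendants, so they end in the other, [E k] small carrier. *)
Lemma limit_cont b x y k : gside b limit_graph x y ->
  exists l, forall x' y', gside b limit_graph x' y' -> E l x x' -> E k y y'.
Proof.
move=> /limit_side[n [p [np pxy]]].
have [q mq qxy] := pieces_graph np pxy (leq_maxl n k).
have [q' [qq' q'xy _ q'y]] := child_graph (maxn n k) (pieces_good mq) qxy.
have mq' : pieces (maxn n k).+1 q' by exists q.
have [[Uo _] _ _] := pieces_good mq' b.
have [l lP] := Uo x (graph_sub mq' q'xy).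
exists l => x' y' /limit_side[m [s [ms sxy]]] /lP q'x'.
apply: (ultra_le uE (leq_maxr n k)); apply: q'y.
have [t Mt txy] := pieces_graph ms sxy (leq_maxr (maxn n k).+1 m).
have [t' mt' tt'] := pieces_ancestor (leq_maxl (maxn n k).+1 m) Mt.
have -> : q' = t'.
  by apply: (pieces_inj mq' mt' q'x'); apply: tt'; exact: (graph_sub Mt txy).
apply: tt'; apply: (graph_sub Mt (y := x')).
by case: (b) txy.
Qed.

Lemma limit_homeomorphism : exists f : bool -> T -> T, forall b,
  [/\ cancel (f b) (f (~~ b)), ucontinuous E (f b) &
      forall x, D b x -> D (~~ b) (f b x)].
Proof.
pose f b x := sval (cid (limit_total b x)).
have fP b x : gside b limit_graph x (f b x) by rewrite /f; case: cid.
exists f => b; split=> [x|x k|x].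
- apply: (limit_fun (fP (~~ b) (f b x))).
  by have := fP b x; case: (b).
- have [l lP] := limit_cont k (fP b x).
  by exists l => y; apply: lP; exact: fP.
have /limit_side[n [p [np pxy]]] := fP b x.
by have [_ _ pm] := pieces_good np b; exact: (pmap_base pm pxy).
Qed.

End BackAndForth.

(** * Partial maps from embeddings and points, and the schedule of tasks *)

Record closed_embedding (T : Type) (E : nat -> T -> T -> Prop) (e : T -> T) : Prop :=
  ClosedEmbedding {
    emb_inj : injective e;
    emb_cont : ucontinuous E e;
    emb_inv : forall x k, exists l, forall y, E l (e x) (e y) -> E k x y;
    emb_closed : forall A, uclosed E A -> uclosed E (e @` A) }.

Section Matching.
Variables (T : Type) (E : nat -> T -> T -> Prop).
Hypothesis uE : ultra E.
Hypothesis sepE : forall x y, (forall n, E n x y) -> x = y.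

Lemma uclosed_subsingleton (A : set T) :
  (forall x y, A x -> A y -> x = y) -> uclosed E A.
Proof.
move=> A1 x nAx; have [[a Aa]|nA] := pselect (exists a, A a); last first.
  by exists 0%N => y _ Ay; apply: nA; exists y.
have [n nxa] : exists n, ~ E n x a.
  by apply/existsNP => /sepE xa; apply: nAx; rewrite xa.
by exists n => y xy Ay; apply: nxa; rewrite (A1 _ _ Aa Ay).
Qed.

Hypothesis no_isolated : forall x n, exists x', E n x x' /\ x' <> x.

Lemma pmap_empty (D D' U : set T) : pmap E D D' U (fun _ _ => False).
Proof.
by split=> // x _; exists 0%N => y _ [].
Qed.

Lemma pmap_point (D D' U : set T) a a' : U a -> D' a' ->
  pmap E D D' U (fun x y => x = a /\ y = a').
Proof.
move=> Ua Da'; have dom : gdom (fun x y => x = a /\ y = a') `<=` [set a].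
  by move=> x [y []].
split=> [x y [-> _]//|x y y' [_ ->] [_ ->]//||x y k [-> ->]|x y n [-> _]|x y [_ ->]//].
- by apply: uclosed_subsingleton => x y /dom -> /dom ->.
- by exists 0%N => x' y' [_ ->] _; exact: (ultra_refl uE).
- by have [x' [ax' nx']] := no_isolated a n; exists x'; split=> // /dom.
Qed.

Variables (D : bool -> set T) (d : bool -> nat -> T).
Hypothesis dD : forall b x, D b x <-> exists n, d b n = x.
Hypothesis denseD : forall b x n, exists y, D b y /\ E n x y.

(** Thinness on both sides comes from density, since [A] misses [D b] and the image misses
    [D (~~ b)]; for the same reason the conditions on base points are vacuous. *)
Lemma pmap_embedding b (A U U' : set T) (e : T -> T) :
  closed_embedding E e -> uclosed E A -> uclosed E U -> A `<=` ~` D b ->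
  (forall x, U' (e x) /\ ~ D (~~ b) (e x)) ->
  pmap E (D b) (D (~~ b)) U (fun x y => [/\ A x, U x & y = e x]) /\
  pmap E (D (~~ b)) (D b) U' (fun y x => [/\ A x, U x & y = e x]).
Proof.
move=> [einj econt einv eclosed] Acl Ucl AD eU; split.
  split=> [x y []//|x y y' [_ _ ->] [_ _ ->]//||x y k [_ _ ->]|x y n [Ax _ _]|x y [/AD]//].
  - have -> : gdom (fun x y => [/\ A x, U x & y = e x]) = A `&` U.
      by apply/seteqP; split=> [x [y []]|x []] //; exists (e x).
    exact: uclosedI.
  - have [l lP] := econt x k; exists l => x' _ [_ _ ->]; exact: lP.
  - have [x' [Dx' xx']] := denseD b x n; exists x'; split=> // -[y' [Ax' _ _]].
    exact: (AD _ Ax' Dx').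
split=> [y x [_ _ ->]|y x x' [_ _ ->] [_ _ /einj]//||y x k [_ _ ->]|y x n [_ _ ->]|y x [_ _ ->]].
- by have [] := eU x.
- have -> : gdom (fun y x => [/\ A x, U x & y = e x]) = e @` (A `&` U).
    by apply/seteqP; split=> [y [x [? ? ->]]|_ [x [? ?] <-]]; [exists x|exists x].
  by apply: eclosed; exact: uclosedI.
- have [l lP] := einv x k; exists l => _ x' [_ _ ->]; exact: lP.
- have [y' [Dy' yy']] := denseD (~~ b) (e x) n; exists y'; split=> // -[x' [_ _ y'E]].
  by have [_] := eU x'; rewrite -y'E.
- by have [] := eU x.
Qed.

Hypothesis embed : forall b U, uopen E U -> U !=set0 ->
  exists e, closed_embedding E e /\ forall x, U (e x) /\ ~ D b (e x).

Variable F : bool -> nat -> set T.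
Hypothesis Fcl : forall b n, uclosed E (F b n).
Hypothesis FD : forall b x, (exists n, F b n x) <-> ~ D b x.

(** Each code concerns a single side: [inl n] schedules a closed set off the dense set, [inr n] a
    point of the dense set. *)
Let task b c : set T :=
  match choice.unpickle c : option (bool * (nat + nat)) with
  | Some (b', t) => if b == b' then
      match t with inl n => F b n | inr n => [set d b n] end else set0
  | None => set0
  end.

Lemma homeomorphism_matching (x0 : T) : exists f : bool -> T -> T, forall b,
  [/\ cancel (f b) (f (~~ b)), ucontinuous E (f b) &
      forall x, D b x -> D (~~ b) (f b x)].
Proof.
have /choice[ret retP] (A : set T) : exists r, uclosed E A -> A !=set0 -> uretraction E A r.
  have [[Acl A0]|nA] := pselect (uclosed E A /\ A !=set0); last first.
    by exists id => Acl A0; case: nA.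
  by have [r] := uretraction_exists uE Acl A0; exists r.
have /choice[up upP] (cU : nat * (bool -> set T)) : exists G,
    (forall b, uclopen E (cU.2 b) /\ cU.2 b !=set0) -> forall b,
    pmap E (D b) (D (~~ b)) (cU.2 b) (gside b G) /\
    task b cU.1 `&` cU.2 b `<=` gdom (gside b G).
  case: cU => c U /=; have [Ug|nUg] := pselect (forall b, uclopen E (U b) /\ U b !=set0); last first.
    by exists (fun _ _ => False).
  have empty b : pmap E (D b) (D (~~ b)) (U b) (@gside T b (fun _ _ => False)).
    by case: b; exact: pmap_empty.
  rewrite /task; case: choice.unpickle => [[b t]|]; last first.
    by exists (fun _ _ => False) => _ b; split=> // x [].
  (* The graph is built with side [b] as its domain; the involution [gside b] then restores the
     orientation. *)
  suff [H [H1 H2 KH]] : exists H, [/\ pmap E (D b) (D (~~ b)) (U b) H,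
      pmap E (D (~~ b)) (D b) (U (~~ b)) (fun y x => H x y) &
      match t with inl n => F b n | inr n => [set d b n] end `&` U b `<=` gdom H].
    exists (gside b H) => _ b'; case: eqP => [->|/eqP bb'].
      by have -> : gside b (gside b H) = H by case: (b).
    have -> : b' = ~~ b by case: b b' bb' {H H1 H2 KH} => -[].
    have -> : gside (~~ b) (gside b H) = (fun y x => H x y) by case: (b).
    by rewrite negbK; split=> // x [].
  have [[Uo Ucl] _] := Ug b; have [[U'o _] U'0] := Ug (~~ b).
  case: t => n.
    have [e [eemb eU]] := embed (~~ b) U'o U'0.
    have FnD : F b n `<=` ~` D b by move=> x Fx; apply/FD; exists n.
    have [H1 H2] := pmap_embedding eemb (@Fcl b n) Ucl FnD eU.
    exists (fun x y => [/\ F b n x, U b x & y = e x]); split=> //.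
    by move=> x [Fx Ux]; exists (e x).
  have [Ud|nUd] := pselect (U b (d b n)); last first.
    exists (fun _ _ => False); split; [exact: pmap_empty|exact: pmap_empty|].
    by move=> x [->].
  have [u Uu] := U'0; have [l lU] := U'o u Uu; have [d' [Dd' /lU Ud']] := denseD (~~ b) u l.
  have Dd : D b (d b n) by apply/dD; exists n.
  exists (fun x y => x = d b n /\ y = d'); split.
  - exact: pmap_point.
  - have -> : (fun y x => x = d b n /\ y = d') = (fun y x => y = d' /\ x = d b n).
      by apply/funext => y; apply/funext => x; apply/propext; split=> -[].
    exact: pmap_point.
  - by move=> x [-> _]; exists d'.
apply: (@limit_homeomorphism T E uE D task _ x0 (fun c U => up (c, U)) _ ret) => //.
- move=> b x; have [/dD[n dx]|/FD[n Fx]] := pselect (D b x).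
    exists (choice.pickle (b, inr n : nat + nat)); rewrite /task choice.pickleK eqxx.
    by rewrite -dx.
  by exists (choice.pickle (b, inl n : nat + nat)); rewrite /task choice.pickleK eqxx.
- by move=> c U; exact: (upP (c, U)).
Qed.

End Matching.

(** * Finitely supported sequences in a lambda-set *)

Section FiniteSupport.
Variables (K : Type) (f : K -> nat -> nat) (z0 : K).
Hypothesis finj : injective f.

Definition fsupp := {x : nat -> K | exists N, forall i, (N <= i)%N -> x i = z0}.

(** This encodes the product topology, the [n]-th level looking at [n] values of each of the first
    [n] coordinates. *)
Definition fsupp_agree n (x y : fsupp) :=
  forall i, (i < n)%N -> agree n (f (sval x i)) (f (sval y i)).

Lemma fsupp_eq (x y : fsupp) : (forall i, sval x i = sval y i) -> x = y.
Proof.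
case: x y => [x hx] [y hy] /= /funext xy; subst y.
by rewrite (Prop_irrelevance hx hy).
Qed.

Lemma fsupp_ultra : ultra fsupp_agree.
Proof.
split=> [n x i _ j _//|n x y xy i ni j nj|n y x z xy yz i ni j nj|n m x y nm xy i ni j nj|x y i//].
- by rewrite xy.
- by rewrite xy ?yz.
- by rewrite (xy i (leq_trans ni nm) j (leq_trans nj nm)).
Qed.

Lemma fsupp_agree_eq (x y : fsupp) : (forall n, fsupp_agree n x y) -> x = y.
Proof.
move=> xy; apply: fsupp_eq => i; apply: finj; apply/funext => j.
by apply: (xy (maxn i j).+1); rewrite ltnS ?leq_maxl ?leq_maxr.
Qed.

(** There are countably many finite tables of values; one point is chosen for each table that some
    point fits. *)
Lemma fsupp_dense : exists d : nat -> fsupp, forall x n, exists k, fsupp_agree n x (d k).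
Proof.
have x0 : fsupp by exists (fun=> z0), 0%N.
pose fits (t : nat * seq (seq nat)) (x : fsupp) := forall i j,
  (i < t.1)%N -> (j < t.1)%N -> f (sval x i) j = nth 0%N (nth [::] t.2 i) j.
have /choice[r rP] t : exists x, forall y, fits t y -> fits t x.
  have [[x tx]|nt] := pselect (exists x, fits t x); first by exists x.
  by exists x0 => y ty; case: nt; exists y.
exists (fun k => r (odflt (0%N, [::]) (choice.unpickle k))) => x n.
pose t := (n, mkseq (fun i => mkseq (f (sval x i)) n) n).
have tx : fits t x by move=> i j ni nj; rewrite /= !nth_mkseq.
exists (choice.pickle t); rewrite choice.pickleK => i ni j nj.
by rewrite (tx i j)// (rP t x tx i j).
Qed.

(** Let [c] list all coordinates of all [d n]. A point with a coordinate off [c] is caught by the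
    sets [Z] of that coordinate; the remaining points are countably many and are caught as
    singletons. *)
Lemma fsupp_lambda (d : nat -> fsupp) : lambda_set f ->
  exists F : nat -> set fsupp, (forall n, uclosed fsupp_agree (F n)) /\
    forall x, (exists n, F n x) <-> (forall n, d n <> x).
Proof.
move=> lam; pose c k := let: (n, i) := odflt (0%N, 0%N) (choice.unpickle k) in sval (d n) i.
have cE n i : c (choice.pickle (n, i)) = sval (d n) i by rewrite /c choice.pickleK.
(* The index of [z0] is the default of [nth], so a finite list of indices codes a whole eventually
   constant sequence. *)
have [n0 cn0] : exists n0, c n0 = z0.
  have [N /(_ N (leqnn N)) dN] := svalP (d 0%N).
  by exists (choice.pickle (0%N, N)); rewrite cE.
have [Z [Zcl Zc]] := lam c.
pose F (t : nat * nat + seq nat) : set fsupp := match t with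
  | inl (i, m) => [set x | Z m (sval x i)]
  | inr s => [set x | (forall i, sval x i = c (nth n0 s i)) /\ forall n, d n <> x] end.
exists (fun k => odflt set0 (omap F (choice.unpickle k))); split=> [k|x].
  case: choice.unpickle => [[[i m]|s]|] /=.
  - move=> x /= /Zcl[n nP]; exists (maxn i.+1 n) => y xy; apply: nP => j jn.
    by apply: xy; rewrite leq_max ?leqnn// jn orbT.
  - apply: uclosed_subsingleton; first exact: fsupp_agree_eq.
    by move=> x y [xs _] [ys _]; apply: fsupp_eq => i; rewrite xs ys.
  - by move=> x _; exists 0%N => y _ [].
split=> [[k]|nd].
  case: choice.unpickle => [[[i m]|s]|] //= => [Zx n dx|[]//].
  have /Zc/(_ (choice.pickle (n, i))) : exists m, Z m (sval x i) by exists m.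
  by rewrite cE dx.
have [[i [m Zx]]|nZ] := pselect (exists i m, Z m (sval x i)).
  by exists (choice.pickle (inl (i, m) : nat * nat + seq nat)); rewrite choice.pickleK.
have /choice[k kP] i : exists k, c k = sval x i.
  apply: contrapT => nk; apply: nZ; exists i; apply/Zc => n cn.
  by apply: nk; exists n.
have [N NP] := svalP x.
exists (choice.pickle (inr (mkseq k N) : nat * nat + seq nat)).
rewrite choice.pickleK /=; split=> // i.
have [iN|Ni] := ltnP i N; first by rewrite nth_mkseq.
by rewrite nth_default ?size_mkseq// cn0 NP.
Qed.

(* The copy of the space inside the cylinder of [x1] that has a new coordinate
   [z] right after the first [n] ones. *)
Lemma fsupp_embed (d : nat -> fsupp) (U : set fsupp) :
  (forall c : nat -> K, exists z, forall n, c n <> z) ->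
  uopen fsupp_agree U -> U !=set0 ->
  exists e, closed_embedding fsupp_agree e /\ forall x, U (e x) /\ forall m, d m <> e x.
Proof.
move=> unc Uo [x1 Ux1]; have [n nU] := Uo x1 Ux1.
have [z zP] := unc (fun m => sval (d m) n).
pose g (x : nat -> K) i :=
  if (i < n)%N then sval x1 i else if i == n then z else x (i - n.+1)%N.
have gsupp (x : fsupp) : exists N, forall i, (N <= i)%N -> g (sval x) i = z0.
  have [N NP] := svalP x; exists (N + n.+1)%N => i Ni.
  have ni : (n < i)%N by apply: leq_trans Ni; rewrite leq_addl.
  by rewrite /g ltnNge (ltnW ni)/= gtn_eqF// NP// leq_subRL 1?addnC// ltnW.
pose e (x : fsupp) : fsupp := exist _ _ (gsupp x).
have eS x i : sval (e x) (n.+1 + i) = sval x i.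
  have ni : (n < n.+1 + i)%N by rewrite addSn ltnS leq_addr.
  by rewrite /= /g ltnNge (ltnW ni)/= (gtn_eqF ni) addKn.
have en x : sval (e x) n = z by rewrite /= /g ltnn eqxx.
have elt x i : (i < n)%N -> sval (e x) i = sval x1 i by rewrite /= /g => ->.
have einv x y k : fsupp_agree (n.+1 + k) (e x) (e y) -> fsupp_agree k x y.
  move=> exy i ik j jk; rewrite -(eS x) -(eS y) exy ?ltn_add2l//.
  by rewrite (leq_trans jk)// leq_addl.
have einj : injective e.
  by move=> x y exy; apply: fsupp_eq => i; rewrite -(eS x) -(eS y) exy.
exists e; split; last first.
  move=> x; split; last by move=> m dm; apply: (zP m); rewrite dm en.
  by apply: nU => i ni j nj; rewrite elt.
split=> // [x k|x k|A Acl y nAy].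
- exists k => y xy i ik; rewrite /= /g; case: ifP => // _; case: ifP => // _.
  by apply: xy; apply: leq_ltn_trans ik; rewrite leq_subr.
- by exists (n.+1 + k)%N => y; exact: einv.
have [[x yx]|ny] := pselect (exists x, e x = y).
  have nAx : ~ A x by move=> Ax; apply: nAy; exists x.
  have [k kP] := Acl x nAx; exists (n.+1 + k)%N => y' yy' [x' Ax' x'y'].
  by apply: (kP x') => //; apply: einv; rewrite yx x'y'.
(* If [y] had the prescribed coordinates up to [n], its shift would be a preimage under [e]. *)
have [k [kn ek]] : exists k, (k <= n)%N /\ forall x, sval (e x) k <> sval y k.
  apply: contrapT => nk; apply: ny.
  have [N NP] := svalP y.
  have ysupp : exists N, forall i, (N <= i)%N -> sval y (n.+1 + i)%N = z0.
    by exists N => i Ni; apply: NP; rewrite (leq_trans Ni)// leq_addl.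
  exists (exist _ (fun i => sval y (n.+1 + i)%N) ysupp); apply: fsupp_eq => i.
  have [ni|] := ltnP n i; first by rewrite -(subnKC ni) eS.
  move=> ilen; apply: contrapT => ei; apply: nk; exists i; split=> // x.
  by move: ilen; rewrite leq_eqVlt => /predU1P[iE|iE]; move: ei; rewrite ?iE ?en ?elt.
have [j ej] : exists j, forall x, f (sval (e x) k) j <> f (sval y k) j.
  have ekE x x' : sval (e x) k = sval (e x') k.
    by move: kn; rewrite leq_eqVlt => /predU1P[->|kn]; rewrite ?en ?elt.
  have [j jP] : exists j, f (sval (e x1) k) j <> f (sval y k) j.
    by apply/existsNP => H; apply: (ek x1); apply: finj; apply/funext.
  by exists j => x; rewrite (ekE x x1).
exists (maxn k j).+1 => y' yy' [x _ xy']; apply: (ej x).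
by rewrite xy' yy' ?ltnS ?leq_maxl ?leq_maxr.
Qed.

(** A sequence is coded by a bound on its support and the iterated pairing of the coordinates below
    it; equal bounds let the pairing be undone step by step. *)
Lemma fsupp_card (i : nat -> K) : injective i -> [set: fsupp] #= [set: K].
Proof.
move=> iinj; have [p pinj] := square_inj iinj.
apply/card_eqPle; split; last first.
  have ssupp (z : K) : exists N, forall i, (N <= i)%N -> (if i == 0%N then z else z0) = z0.
    by exists 1%N => -[].
  apply: (@injective_card_le _ _ (fun z => exist _ _ (ssupp z) : fsupp)) => z z' zz'.
  exact: (congr1 (fun x : fsupp => sval x 0%N) zz').
pose code (x : nat -> K) := fix code n := if n is n'.+1 then p (x n') (code n') else z0.
pose N (x : fsupp) := sval (cid (svalP x)).
have NP x j : (N x <= j)%N -> sval x j = z0 by rewrite /N; case: cid => /= M; apply.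
apply: (@injective_card_le _ _ (fun x => p (i (N x)) (code (sval x) (N x)))) => x y.
move=> /pinj[/iinj Nxy]; rewrite -Nxy => cxy.
apply: fsupp_eq => j; have [jN|Nj] := ltnP j (N x); last first.
  by rewrite (NP x)// (NP y)// -Nxy.
move: cxy jN; elim: (N x) => [//|M IH] /= /pinj[xyM /IH{}IH].
by rewrite ltnS leq_eqVlt => /predU1P[->|].
Qed.

End FiniteSupport.

(** * The metric *)

Definition separated (T : Type) (E : nat -> T -> T -> Prop) :=
  forall x y, (forall n, E n x y) -> x = y.

Section UltraMetric.
Variables (R : realType) (T : Type) (E : nat -> T -> T -> Prop).
Hypotheses (uE : ultra E) (sepE : separated E).
Local Open Scope ring_scope.

Lemma split_level x y : x <> y -> exists n, `[< ~ E n x y >].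
Proof.
by move=> xy; apply: contrapT => /forallNP H; apply/xy/sepE => n;
   apply: contrapT => nE; apply: (H n); exact/asboolP.
Qed.

Definition udist (x y : T) : R :=
  if pselect (x = y) is right xy then (ex_minn (split_level xy)).+1%:R^-1 else 0.

Lemma udist_lt n x y : (udist x y < n.+1%:R^-1) <-> E n x y.
Proof.
rewrite /udist; case: pselect => [->|xy].
  by rewrite invr_gt0 ltr0Sn; split=> // _; exact: (ultra_refl uE).
case: ex_minnP => m /asboolP nm mmin; rewrite ltf_pV2 ?posrE ?ltr0Sn// ltr_nat ltnS.
split=> [nltm|nE]; first by apply: contrapT => /asboolP/mmin; rewrite leqNgt nltm.
by rewrite ltnNge; apply/negP => mn; apply: nm; exact: (ultra_le uE mn).
Qed.

Lemma udistxx x : udist x x = 0.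
Proof. by rewrite /udist; case: pselect. Qed.

Lemma udist_ge0 x y : 0 <= udist x y.
Proof. by rewrite /udist; case: pselect => // xy; rewrite invr_ge0. Qed.

Lemma udist_eq0 x y : udist x y = 0 -> x = y.
Proof. by rewrite /udist; case: pselect => // xy /eqP; rewrite invr_eq0 pnatr_eq0. Qed.

Lemma udist_ge n x y : ~ E n x y -> n.+1%:R^-1 <= udist x y.
Proof. by move=> /udist_lt/negP; rewrite -leNgt. Qed.

Lemma udist_sym x y : udist x y = udist y x.
Proof.
have le u v : udist u v <= udist v u.
  rewrite {1}/udist; case: pselect => [uv|uv]; first exact: udist_ge0.
  case: ex_minnP => m /asboolP nm _; apply: udist_ge => vu.
  by apply: nm; exact: (ultra_sym uE).
by apply/eqP; rewrite eq_le !le.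
Qed.

Lemma udist_triangle y x z : udist x z <= udist x y + udist y z.
Proof.
rewrite {1}/udist; case: pselect => [xz|xz]; first by rewrite addr_ge0 ?udist_ge0.
case: ex_minnP => m /asboolP nm _.
have [xy|/udist_ge xy] := pselect (E m x y); last first.
  by apply: (le_trans xy); rewrite lerDl udist_ge0.
have [yz|/udist_ge yz] := pselect (E m y z).
  by case: nm; exact: (ultra_trans uE xy yz).
by apply: (le_trans yz); rewrite lerDr udist_ge0.
Qed.

(** The alias carries the proofs as arguments, so that the metric instance can depend on them. *)
Definition ultra_space of ultra E & separated E := T.

Local Notation X := (ultra_space uE sepE).

HB.instance Definition _ := gen_eqMixin X.
HB.instance Definition _ := gen_choiceMixin X.
HB.instance Definition _ := @isMetric.Build R X udist udistxx udist_eq0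
  udist_sym udist_triangle.

Lemma ultra_nbhsP (x : X) (A : set X) :
  nbhs x A <-> exists n, forall y : X, E n x y -> A y.
Proof.
rewrite -(@nbhs_ballE R X) /nbhs_ball_; split=> [[e /= e0 xA]|[n nA]].
  have [n ne] : exists n, n.+1%:R^-1 < e.
    exists (Num.bound e^-1); rewrite invf_plt ?posrE ?ltr0Sn//.
    apply: lt_trans (archi_boundP _) _; first by rewrite invr_ge0 ltW.
    by rewrite ltr_nat.
  exists n => y xy; apply: xA; rewrite ballEmdist /=; apply: lt_trans ne.
  exact/udist_lt.
exists n.+1%:R^-1 => /=; first by rewrite invr_gt0.
by move=> y; rewrite ballEmdist /= => /udist_lt/nA.
Qed.

Lemma ultra_openP (U : set X) : open U <-> uopen E U.
Proof.
rewrite openE; split=> [Uo x /Uo|Uo x /Uo]; first by move=> /ultra_nbhsP.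
by move=> nU; apply/ultra_nbhsP.
Qed.

Lemma ultra_closed (A : set X) : uclosed E A -> closed A.
Proof. by move=> Acl; rewrite -openC; exact/ultra_openP. Qed.

Lemma ultra_continuous (f : X -> X) : ucontinuous E f -> continuous f.
Proof.
move=> fc x A /ultra_nbhsP[n nA]; apply/ultra_nbhsP.
by have [m mP] := fc x n; exists m => y /mP/nA.
Qed.

Lemma ultra_dense (D : set X) :
  dense D <-> forall x n, exists y, D y /\ E n x y.
Proof.
split=> [Dd x n|Dd U [x Ux] /ultra_openP/(_ x Ux)[n nU]].
  have [||y [xy Dy]] := Dd [set y | E n x y]; last by exists y.
    by exists x; exact: (ultra_refl uE).
  by apply/ultra_openP => y xy; exists n => z; exact: (ultra_trans uE xy).
by have [y [Dy /nU Uy]] := Dd x n; exists y.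
Qed.

Lemma ultra_nowhere_dense (A : set X) : uclosed E A ->
  (forall x n, exists y, E n x y /\ ~ A y) -> nowhere_dense A.
Proof.
move=> /ultra_closed/closure_id Acl thin; rewrite /nowhere_dense -Acl.
apply/seteqP; split=> // x /ultra_nbhsP[n nA].
by have [y [/nA Ay]] := thin x n.
Qed.

End UltraMetric.

(** * Countability facts and assembly of the space *)

Lemma countable_range (T : Type) (D : set T) x0 : countable D -> D x0 ->
  exists d : nat -> T, forall x, D x <-> exists n, d n = x.
Proof.
move=> /countable_injP[g ginj] Dx0.
have /choice[d dP] n : exists x, D x /\ forall y, D y -> g y = n -> y = x.
  have [[x [Dx gx]]|nx] := pselect (exists x, D x /\ g x = n).
    exists x; split=> // y Dy gy; rewrite -gx in gy.
    by apply: ginj => //; exact: mem_set.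
  by exists x0; split=> // y Dy gy; case: nx; exists y.
exists d => x; split=> [Dx|[n <-]]; last by have [] := dP n.
by exists (g x); have [_ /(_ x Dx erefl)] := dP (g x).
Qed.

Lemma omega1_le_uncountable (K : Type) :
  [set: omega1] #<= [set: K] -> uncountable K.
Proof.
move=> oK cK; have [] : uncountable omega1.
  by rewrite /omega1; case: cid => /= k [].
exact: (sub_countable oK).
Qed.

Lemma uncountable_avoid (K : Type) : uncountable K ->
  forall c : nat -> K, exists z, forall n, c n <> z.
Proof.
move=> unc c; apply: contrapT => /forallNP H; apply: unc.
have -> : [set: K] = range c.
  apply/seteqP; split=> // z _.
  by have /existsNP[n /contrapT cn] := H z; exists n.
exact: (card_image_le c).
Qed.

Lemma uncountable_infinite (K : Type) : uncountable K ->
  exists i : nat -> K, injective i.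
Proof.
move=> unc; apply: card_leT_inj; apply/infiniteP => fin.
by apply: unc; exact: finite_set_countable.
Qed.

Theorem corollary4p3 (R : realType) (kappa : Type) :
  [set: omega1] #<= [set: kappa] ->
  [set: kappa] #<= [set: bounding_number] ->
  exists X : metricType R,
    [/\ meager_in_itself X, countable_dense_homogeneous X &
        [set: X] #= [set: kappa]].
Proof.
move=> oK Kb; have uncK := omega1_le_uncountable oK.
have unc := uncountable_avoid uncK.
have [i iinj] := uncountable_infinite uncK.
have [f [finj flam]] := lambda_set_exists Kb.
pose z0 := i 0%N; pose T := fsupp z0.
pose E : nat -> T -> T -> Prop := @fsupp_agree _ f z0.
have uE : ultra E := fsupp_ultra f z0.
have sepE : separated E := @fsupp_agree_eq _ f z0 finj.
pose X : metricType R := ultra_space uE sepE.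
have t0 : T by exists (fun=> z0), 0%N.
have no_isolated (x : T) n : exists x', E n x x' /\ x' <> x.
  (* Embedding the space into the class of [x] while avoiding the constant sequence [x] yields a
     different point there. *)
  have [||e [_ /(_ x)[xe xx]]] := fsupp_embed finj (fun=> x) (U := [set y | E n x y]) unc.
  - by move=> y xy; exists n => z; exact: (ultra_trans uE xy).
  - by exists x; exact: (ultra_refl uE).
  by exists (e x); split=> // exx; apply: (xx 0%N).
have [d0 d0P] := fsupp_dense f z0.
exists X; split; last exact: (@fsupp_card _ z0 i iinj).
- have [F [Fcl FP]] := fsupp_lambda finj d0 flam.
  (* The sets [F n] are closed and miss a dense set; singletons are nowhere dense as no point is
     isolated. *)
  pose A (t : nat + nat) : set T :=
    match t with inl n => F n | inr n => [set d0 n] end.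
  exists (fun k => odflt set0 (omap A (choice.unpickle k))); split=> [k|].
    case: choice.unpickle => [[n|n]|] /=; apply: ultra_nowhere_dense.
    + exact: Fcl.
    + move=> x m; have [k' xk] := d0P x m; exists (d0 k'); split=> // Fd.
      by have /FP/(_ k') : exists n, F n (d0 k') by exists n.
    + by apply: (uclosed_subsingleton sepE) => x y -> ->.
    + move=> x m; have [xd|xd] := pselect (x = d0 n); last first.
        by exists x; split=> //; exact: (ultra_refl uE).
      by rewrite -xd; have [x' [? ?]] := no_isolated x m; exists x'.
    + by move=> x _; exists 0%N => y _ [].

    + by move=> x m; exists x; split=> //; exact: (ultra_refl uE).
  apply/seteqP; split=> // x _.
  have [[n Fx]|nF] := pselect (exists n, F n x).
    by exists (choice.pickle (inl n : nat + nat)); rewrite // choice.pickleK.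
  have [n dx] : exists n, d0 n = x.
    apply: contrapT => nd; apply: nF; apply/FP => n dn; apply: nd.
    by exists n.
  by exists (choice.pickle (inr n : nat + nat)); rewrite // choice.pickleK.
split.
  exists (range d0); split; first exact: (card_image_le d0).
  apply/ultra_dense => x n; have [k xk] := d0P x n.
  by exists (d0 k); split=> //; exists k.
move=> D D' Dc /ultra_dense Dd D'c /ultra_dense D'd.
pose DD (b : bool) : set T := if b then D else D'.
have DDd b : forall x n, exists y, DD b y /\ E n x y by case: b.
have /choice[d dP] b : exists d : nat -> T, forall x, DD b x <-> exists n, d n = x.
  have [y [Dy _]] := DDd b t0 0%N.
  by apply: countable_range Dy; case: (b).
have /choice[F FP] b : exists F : nat -> set T, (forall n, uclosed E (F n)) /\
    forall x, (exists n, F n x) <-> (forall n, d b n <> x).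
  exact: fsupp_lambda.
have [|||h hP] := homeomorphism_matching uE sepE no_isolated dP DDd _ (F := F) _ _ t0.
- move=> b U Uo U0; have [e [eemb eU]] := fsupp_embed finj (d b) unc Uo U0.
  exists e; split=> // x; have [Ux nd] := eU x; split=> // /dP[n].
  exact: nd.
- by move=> b n; have [] := FP b.
- move=> b x; split=> [/(FP b).2 nd /dP[n]|nD]; first exact: nd.
  by apply/(FP b).2 => n dx; apply: nD; apply/dP; exists n.
have [hK hc hD] := hP true; have [h'K h'c h'D] := hP false.
exists (h true); split.
  exists (h false); split=> //; exact: ultra_continuous.
apply/seteqP; split=> [_ [x Dx <-]|y D'y]; first exact: hD.
by exists (h false y); [exact: h'D|exact: h'K].
Qed.
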